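(* Let $n,r_1,\ldots,r_l\in\mathbb{Z}\setminus\{0\}$, with $n\geqslant 2$ if $n>0$. Then $$S(n;r_1,\ldots,r_l)=(-1)^{\kappa}\,\zeta\big((n,(r_1)\ast(r_2)\ast\cdots\ast(r_l))\big),$$ where $\kappa=\#\{i : r_i<0\}$. In particular, every $S(n;r_1,\ldots,r_l)$ is a $\mathbb{Z}$-linear combination of alternating Euler sums of weight $|n|+|r_1|+\cdots+|r_l|$ and depth at most $l+1$.
   Context: For integers $k,r\geqslant 1$ let $H_k^{(r)}=\sum_{j=1}^k j^{-r}$ and $\overline{H}_k^{(r)}=\sum_{j=1}^k (-1)^{j+1}j^{-r}$. For a nonzero integer $r$ put $X_k^{(r)}=H_k^{(r)}$ if $r>0$ and $X_k^{(r)}=\overline{H}_k^{(-r)}$ if $r<0$. For nonzero integers $n,r_1,\ldots,r_l$ (with $n\geqslant2$ if $n>0$) define the harmonic sum $S(n;r_1,\ldots,r_l)=\sum_{k=1}^\infty \frac{X_k^{(r_1)}\cdots X_k^{(r_l)}}{(k+1)^n}$ if $n>0$, and $S(n;r_1,\ldots,r_l)=\sum_{k=1}^\infty (-1)^{k+1}\frac{X_k^{(r_1)}\cdots X_k^{(r_l)}}{(k+1)^{|n|}}$ if $n<0$. Alternating Euler sums: for a finite sequence $(k_1,\ldots,k_d)$ of nonzero integers with $k_1\neq 1$, $\zeta(k_1,\ldots,k_d)=\sum_{m_1>\cdots>m_d>0}\prod_{i=1}^d \frac{\operatorname{sgn}(k_i)^{m_i}}{m_i^{|k_i|}}$; its weight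 is $\sum|k_i|$ and depth $d$. (The paper writes a negative entry $-k$ as $\bar k$.) Let $\mathscr{S}$ be the free abelian group generated by all finite sequences of nonzero integers, including the empty sequence denoted $1$. Concatenation $(\alpha,\beta)$ of sequences is extended bilinearly to $\mathscr{S}$, and for an integer $n$ and $\alpha\in\mathscr{S}$, $(n,\alpha)$ denotes the concatenation of the length-one sequence $(n)$ with $\alpha$. For $\alpha=\sum a_i\alpha_i$ set $\zeta(\alpha)=\sum a_i\zeta(\alpha_i)$. The harmonic product $\ast$ on $\mathscr{S}$ is the bilinear product defined recursively by $1\ast\alpha=\alpha\ast1=\alpha$ and $(k,\alpha)\ast(l,\beta)=(k,\alpha\ast(l,\beta))+(l,(k,\alpha)\ast\beta)+(p(k,l),\alpha\ast\beta)$ for nonzero integers $k,l$ and sequences $\alpha,\beta$, where $p(k,l)=\operatorname{sgn}(k)\operatorname{sgn}(l)(|k|+|l|)$. *)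

(* Defs.v *)
From mathcomp Require Import all_boot all_order all_algebra.
From mathcomp Require Import all_classical all_reals all_analysis.
From mathcomp Require Import freeg.

Set Implicit Arguments.
Unset Strict Implicit.
Unset Printing Implicit Defensive.

Import Order.TTheory GRing.Theory Num.Theory.
Import numFieldNormedType.Exports.

Local Open Scope ring_scope.

Definition nzint := {k : int | k != 0}.

Definition nzval (k : nzint) : int := val k.
Coercion nzval : nzint >-> int.

Definition harm (R : realType) (r k : nat) : R :=
  \sum_(1 <= j < k.+1) (j%:R ^+ r)^-1.

Definition alt_harm (R : realType) (r k : nat) : R :=
  \sum_(1 <= j < k.+1) (-1) ^+ j.+1 * (j%:R ^+ r)^-1.

Definition Xharm (R : realType) (r : nzint) (k : nat) : R :=
  if 0 < nzval r then harm R `|r|%N k else alt_harm R `|r|%N k.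

Definition Sterm (R : realType) (n : nzint) (rs : seq nzint) (k : nat) : R :=
  if 0 < nzval n then (\prod_(r <- rs) Xharm R r k) / k.+1%:R ^+ `|n|%N
  else (-1) ^+ k.+1 * (\prod_(r <- rs) Xharm R r k) / k.+1%:R ^+ `|n|%N.

Definition Spartial (R : realType) (n : nzint) (rs : seq nzint) (N : nat) : R :=
  \sum_(1 <= k < N.+1) Sterm R n rs k.

(* [limn] has a junk value on divergent sequences: convergence is a separate
   assertion [cvgn (Spartial R n rs)]. The same remark applies to [zeta]. *)
Definition Ssum (R : realType) (n : nzint) (rs : seq nzint) : R :=
  limn (Spartial R n rs).

Definition admissible (ks : seq nzint) : bool :=
  if ks is k :: _ then nzval k != 1 else true.

Definition weight (ks : seq nzint) : nat := (\sum_(k <- ks) `|nzval k|)%N.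

Definition depth (ks : seq nzint) : nat := size ks.

(* The part N >= m_1 > ... > m_d > 0 of the multiple sum. For k_1 = -1 the
   series is only conditionally convergent, and its value is the limit of these
   truncations, i.e. the outermost summation is over m_1 in increasing order. *)
Definition zeta_partial (R : realType) (ks : seq nzint) (N : nat) : R :=
  \sum_(ms : (size ks).-tuple 'I_N.+1 |
          sorted gtn (rcons [seq nat_of_ord m | m <- ms] 0%N))
    \prod_(km <- zip ks ms)
      ((sgz (nzval km.1))%:~R ^+ nat_of_ord km.2
        / (nat_of_ord km.2)%:R ^+ `|nzval km.1|%N).

Definition zeta (R : realType) (ks : seq nzint) : R :=
  limn (zeta_partial R ks).

Notation sgroup := {freeg (seq nzint) / int}.

Definition word (u : seq nzint) : sgroup := << u >>.

Definition bilin (f : seq nzint -> seq nzint -> sgroup) (a b : sgroup) : sgroup :=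
  fglift (fun u => fglift (f u) b) a.

Definition sconcat : sgroup -> sgroup -> sgroup :=
  bilin (fun u v => word (u ++ v)).

Definition scons (k : nzint) (a : sgroup) : sgroup := sconcat (word [:: k]) a.

Lemma pmerge_subproof (k l : nzint) :
  sgz (nzval k) * sgz (nzval l) * (`|nzval k| + `|nzval l|) != 0.
Proof.
have k0 : nzval k != 0 := valP k; have l0 : nzval l != 0 := valP l.
by rewrite !mulf_neq0 ?sgz_eq0 // paddr_eq0 // !normr_eq0 negb_and k0.
Qed.

Definition pmerge (k l : nzint) : nzint :=
  Sub (sgz (nzval k) * sgz (nzval l) * (`|nzval k| + `|nzval l|))
      (pmerge_subproof k l).

Fixpoint harmonic_word (u : seq nzint) : seq nzint -> sgroup :=
  match u with
  | [::] => word
  | k :: u' =>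
      fix harmonic_cons (v : seq nzint) : sgroup :=
        match v with
        | [::] => word (k :: u')
        | l :: v' =>
            scons k (harmonic_word u' (l :: v'))
            + scons l (harmonic_cons v')
            + scons (pmerge k l) (harmonic_word u' v')
        end
  end.

Lemma harmonic_word_cons (k l : nzint) (u v : seq nzint) :
  harmonic_word (k :: u) (l :: v) =
    scons k (harmonic_word u (l :: v))
    + scons l (harmonic_word (k :: u) v)
    + scons (pmerge k l) (harmonic_word u v).
Proof. by []. Qed.

Definition hproduct : sgroup -> sgroup -> sgroup := bilin harmonic_word.

(* (r_1) * (r_2) * ... * (r_l); the harmonic product is associative with unit
   the empty word, so the bracketing and the final unit are immaterial. *)
Definition harmonic_prod (rs : seq nzint) : sgroup :=
  \big[hproduct/word [::]]_(r <- rs) word [:: r].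

Definition zeta_lin (R : realType) (a : sgroup) : R :=
  \sum_(ks <- dom a) (coeff ks a)%:~R * zeta R ks.

(* Main.v *)
(** The truncations [Z_N(u)] of the alternating Euler sums, over
    [N >= m_1 > ... > m_d > 0], satisfy
    [Z_(N+1)(k,u) = Z_N(k,u) + sgn(k)^(N+1)/(N+1)^|k| Z_N(u)], so by induction
    [u -> Z_N(u)] turns the harmonic product into the ordinary product for
    every [N]. As [X_k^(r)] is [Z_k(r)] up to the sign of [r], the [N]-th
    partial sum of [S(n; r_1, ..., r_l)] is the signed value of [Z_(N+1)] at
    [(n, (r_1) * ... * (r_l))], and the identity follows by letting [N] grow.

    For convergence, [Z_N(u) = O(N^e)] for every [e > 0], which settles
    [|n| >= 2]. For [n = -1] the terms are [(-1)^(m+1) b_m] with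
    [b_m = Z_m(u)/(m+1)] tending to [0]; the series with terms
    [(-1)^m (b_(m+1) - b_m) = O(m^(e-2))] converges, and the alternating series
    with it. *)

Require Import Defs.
From HB Require Import structures.
From mathcomp Require Import all_boot all_order all_algebra.
From mathcomp Require Import all_classical all_reals all_analysis.
From mathcomp Require Import freeg.
From mathcomp Require Import ring lra zify.

Set Implicit Arguments.
Unset Strict Implicit.
Unset Printing Implicit Defensive.

Import Order.TTheory GRing.Theory Num.Theory.
Import numFieldNormedType.Exports.

Local Open Scope classical_set_scope.
Local Open Scope ring_scope.

Section FreegLift.
Variables (G : nzRingType) (K : choiceType).
Implicit Types a : {freeg K / G}.

Lemma fgliftE (M : lmodType G) (g : K -> M) a :
  fglift g a = \sum_(k <- dom a) coeff k a *: g k.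
Proof. by rewrite -[in LHS](Freeg_dom a) fglift_Freeg /prelift big_map. Qed.

Lemma dom_fglift (L : choiceType) (g : K -> {freeg L / G}) a x :
  x \in dom (fglift g a) -> exists2 k, k \in dom a & x \in dom (g k).
Proof.
rewrite fgliftE => /dom_sum_subset /flatten_mapP[k].
by rewrite filter_predT => ka /domZ_subset xk; exists k.
Qed.

End FreegLift.

Section FreegEval.
Variables (K : choiceType) (V : zmodType).
Implicit Types (f : K -> V) (a : {freeg K / int}).

Definition fgeval f a : V := fglift (f : K -> zmodule V) a.

HB.instance Definition _ f := GRing.isZmodMorphism.Build {freeg K / int} V
  (fgeval f) (@lift_is_additive int K (zmodule V) f).

Lemma fgevalE f a : fgeval f a = \sum_(k <- dom a) f k *~ coeff k a.
Proof. exact: (fgliftE (M := zmodule V)). Qed.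

Lemma fgevalU f k : fgeval f << k >> = f k.
Proof. by rewrite /fgeval liftU scale1r. Qed.

Lemma eq_fgeval f g a : f =1 g -> fgeval f a = fgeval g a.
Proof. by move=> fg; rewrite !fgevalE; apply: eq_bigr => k _; rewrite fg. Qed.

Lemma fgeval_sum I (r : seq I) (P : pred I) (F : I -> K -> V) a :
  fgeval (fun k => \sum_(i <- r | P i) F i k) a =
  \sum_(i <- r | P i) fgeval (F i) a.
Proof.
under [RHS]eq_bigr do rewrite fgevalE.
by rewrite fgevalE exchange_big; apply: eq_bigr => k _; rewrite mulrz_suml.
Qed.

End FreegEval.

Lemma fgeval_fglift (K L : choiceType) (V : zmodType) (f : L -> V)
    (g : K -> {freeg L / int}) (a : {freeg K / int}) :
  fgeval f (fglift g a) = fgeval (fun k => fgeval f (g k)) a.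
Proof.
rewrite [RHS]fgevalE fgliftE raddf_sum; apply: eq_bigr => k _.
by rewrite -[coeff k a]intz scaler_int raddfMz intz.
Qed.

Section FreegEvalRing.
Variables (K : choiceType) (V : pzRingType).
Implicit Types (x : V) (f : K -> V) (a : {freeg K / int}).

Lemma fgevalMl x f a : fgeval (fun k => x * f k) a = x * fgeval f a.
Proof.
by rewrite !fgevalE mulr_sumr; apply: eq_bigr => k _; rewrite mulrzAr.
Qed.

Lemma fgevalMr x f a : fgeval (fun k => f k * x) a = fgeval f a * x.
Proof.
by rewrite !fgevalE mulr_suml; apply: eq_bigr => k _; rewrite mulrzAl.
Qed.

End FreegEvalRing.

Lemma cvg_fgeval (R : realType) (K : choiceType) (F : K -> R ^nat) (l : K -> R)
    (a : {freeg K / int}) :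
  {in dom a, forall k, F k @ \oo --> l k} ->
  fgeval (F ^~ N) a @[N --> \oo] --> fgeval l a.
Proof.
move=> cvF; under eq_fun do rewrite fgevalE big_seq.
rewrite fgevalE big_seq; apply: cvg_big => [|k ka]; first exact: add_continuous.
rewrite -mulrzr; under eq_fun do rewrite -mulrzr.
by apply: cvgMr_tmp; exact: cvF.
Qed.

Section Bilin.
Implicit Types (h : seq nzint -> seq nzint -> sgroup) (a b : sgroup).

Lemma fgeval_bilin (V : zmodType) (f : seq nzint -> V) h a b :
  fgeval f (bilin h a b) =
  fgeval (fun u => fgeval (fun v => fgeval f (h u v)) b) a.
Proof.
by rewrite fgeval_fglift; apply: eq_fgeval => u; rewrite fgeval_fglift.
Qed.

Lemma dom_bilin h a b w : w \in dom (bilin h a b) ->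
  exists u v, [/\ u \in dom a, v \in dom b & w \in dom (h u v)].
Proof. by move=> /dom_fglift[u ua /dom_fglift[v vb ?]]; exists u, v. Qed.

Lemma fgeval_scons (V : zmodType) (f : seq nzint -> V) k a :
  fgeval f (scons k a) = fgeval (fun u => f (k :: u)) a.
Proof.
by rewrite fgeval_bilin fgevalU; apply: eq_fgeval => u; rewrite fgevalU.
Qed.

Lemma dom_scons k a w : w \in dom (scons k a) ->
  exists2 u, u \in dom a & w = k :: u.
Proof.
move=> /dom_bilin[s [u]]; rewrite !domU1 !inE => -[/eqP -> ua /eqP ->].
by exists u.
Qed.

End Bilin.

Lemma nzval_neq0 (k : nzint) : nzval k != 0.
Proof. exact: valP k. Qed.

Lemma absz_pmerge (k l : nzint) :
  `|nzval (pmerge k l)|%N = (`|nzval k| + `|nzval l|)%N.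
Proof.
have k0 := nzval_neq0 k; have l0 := nzval_neq0 l.
rewrite [nzval (pmerge k l)]/=.
by rewrite !abszM -!sgrz !absz_sg k0 l0 !mul1n; lia.
Qed.

Lemma sgz_pmerge (k l : nzint) :
  sgz (nzval (pmerge k l)) = sgz (nzval k) * sgz (nzval l).
Proof.
have k0 := nzval_neq0 k; have l0 := nzval_neq0 l.
have kl_gt0 : 0 < `|nzval k| + `|nzval l| by lia.
by rewrite [nzval (pmerge k l)]/= !sgzM !sgz_id (gtr0_sgz kl_gt0) mulr1.
Qed.

Lemma weight_nil : weight [::] = 0%N.
Proof. by rewrite /weight big_nil. Qed.

Lemma weight_cons k u : weight (k :: u) = (`|nzval k| + weight u)%N.
Proof. by rewrite /weight big_cons. Qed.

Lemma dom_harmonic_word u v w : w \in dom (harmonic_word u v) ->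
  weight w = (weight u + weight v)%N /\ (depth w <= depth u + depth v)%N.
Proof.
rewrite /depth; elim: u v w => [|k u IHu] v w.
  by rewrite domU1 inE => /eqP ->; rewrite weight_nil.
elim: v w => [|l v IHv] w.
  by rewrite domU1 inE => /eqP ->; rewrite weight_nil !addn0.
rewrite harmonic_word_cons.
move=> /domD_subset; rewrite mem_cat => /orP[/domD_subset|].
  rewrite mem_cat => /orP[] /dom_scons[x].
    move=> /IHu[wx sx] ->.
    by rewrite !weight_cons wx !weight_cons /= in sx *; lia.
  move=> /IHv[wx sx] ->.
  by rewrite !weight_cons wx !weight_cons /= in sx *; lia.
move=> /dom_scons[x /IHu[wx sx] ->].
by rewrite !weight_cons absz_pmerge wx /=; lia.
Qed.

Lemma dom_harmonic_prod rs w : w \in dom (harmonic_prod rs) ->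
  weight w = weight rs /\ (depth w <= depth rs)%N.
Proof.
elim: rs w => [|r rs IHrs] w.
  by rewrite /harmonic_prod big_nil domU1 inE => /eqP ->.
rewrite /harmonic_prod big_cons => /dom_bilin[u [v []]].
rewrite domU1 inE => /eqP -> /IHrs[wv dv] /dom_harmonic_word[-> dw].
rewrite wv !weight_cons weight_nil addn0; split=> //.
by apply: leq_trans dw _; rewrite /depth ltnS.
Qed.

Lemma big_tuple_cons (S : Type) (idx : S) (op : Monoid.com_law idx)
    (I : finType) d (P : pred (d.+1.-tuple I)) (F : d.+1.-tuple I -> S) :
  \big[op/idx]_(t | P t) F t =
  \big[op/idx]_i \big[op/idx]_(t : d.-tuple I | P [tuple of i :: t])
    F [tuple of i :: t].
Proof.
pose consp (p : I * d.-tuple I) := [tuple of p.1 :: p.2].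
rewrite pair_big_dep (reindex consp) //=.
exists (fun t : d.+1.-tuple I => (thead t, [tuple of behead t])).
  by move=> [i t] _ /=; rewrite theadE; congr pair; apply: val_inj.
by move=> t _; rewrite [RHS]tuple_eta; apply: val_inj.
Qed.

Section NestedSum.
Variables (T : Type) (V : pzRingType) (f : T -> nat -> V).

Fixpoint nested_sum (u : seq T) : V ^nat :=
  if u is k :: u' then series (fun m => f k m.+1 * nested_sum u' m)
  else fun=> 1.

Arguments nested_sum : simpl never.

Lemma nested_sum_cons k u :
  nested_sum (k :: u) = series (fun m => f k m.+1 * nested_sum u m).
Proof. by []. Qed.

Lemma nested_sum_cons0 k u : nested_sum (k :: u) 0 = 0.
Proof. by rewrite nested_sum_cons seriesEnat /= big_geq. Qed.

Lemma nested_sum_consS k u N : nested_sum (k :: u) N.+1 =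
  nested_sum (k :: u) N + f k N.+1 * nested_sum u N.
Proof. exact: seriesSr. Qed.

Lemma sum_tuple_path (u : seq T) (M N : nat) : (M <= N)%N ->
  \sum_(ms : (size u).-tuple 'I_N.+1 |
          path gtn M.+1 (rcons [seq nat_of_ord m | m <- ms] 0%N))
    \prod_(km <- zip u ms) f km.1 (nat_of_ord km.2) = nested_sum u M.
Proof.
elim: u M => [|k u IHu] M leMN.
  rewrite (big_pred1 [tuple]) /= ?big_nil // => t.
  by rewrite (tuple0 t); apply/esym/eqP.
rewrite big_tuple_cons big_ord_recl /= big1 ?add0r; last by case=> -[].
rewrite nested_sum_cons seriesEord /=.
rewrite (big_ord_widen _ (fun m => f k m.+1 * nested_sum u m) leMN).
rewrite [RHS]big_mkcond; apply: eq_bigr => m _; rewrite /bump add1n ltnS /=.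
case: ifPn => [ltmM|_]; last by rewrite big1.
rewrite -IHu ?mulr_sumr; last exact: ltnW.
by apply: eq_bigr => ms _; rewrite big_cons.
Qed.

Lemma sum_tuple_sorted (u : seq T) (N : nat) :
  \sum_(ms : (size u).-tuple 'I_N.+1 |
          sorted gtn (rcons [seq nat_of_ord m | m <- ms] 0%N))
    \prod_(km <- zip u ms) f km.1 (nat_of_ord km.2) = nested_sum u N.
Proof.
rewrite -(sum_tuple_path u (leqnn N)); apply: eq_bigl => ms.
by case: (val ms) => [|m s] //=; rewrite ltn_ord.
Qed.

End NestedSum.
Arguments nested_sum : simpl never.

Section HarmonicProductMorphism.
Variables (V : comPzRingType) (f : nzint -> nat -> V).

Lemma fgeval_nested_sum_cons k (a : sgroup) N :
  fgeval (fun u => nested_sum f (k :: u) N) a =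
  \sum_(0 <= m < N) f k m.+1 * fgeval (nested_sum f ^~ m) a.
Proof.
by rewrite fgeval_sum; apply: eq_bigr => m _; rewrite fgevalMl.
Qed.

Hypothesis f_pmerge : forall k l m, f (pmerge k l) m = f k m * f l m.

Lemma fgeval_nested_sum_harmonic_word u v N :
  fgeval (nested_sum f ^~ N) (harmonic_word u v) =
  nested_sum f u N * nested_sum f v N.
Proof.
elim: u v N => [|k u IHu] v N; first by rewrite fgevalU mul1r.
elim: v N => [|l v IHv] N; first by rewrite fgevalU mulr1.
rewrite harmonic_word_cons !raddfD /= !fgeval_scons !fgeval_nested_sum_cons.
elim: N => [|N IHN]; first by rewrite !big_geq // nested_sum_cons0 mul0r !addr0.
rewrite !big_nat_recr // !nested_sum_consS mulrDl !mulrDr -IHN.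
by rewrite !IHu IHv f_pmerge /=; ring.
Qed.

Lemma fgeval_nested_sum_hproduct a b N :
  fgeval (nested_sum f ^~ N) (hproduct a b) =
  fgeval (nested_sum f ^~ N) a * fgeval (nested_sum f ^~ N) b.
Proof.
rewrite fgeval_bilin -fgevalMr; apply: eq_fgeval => u.
rewrite -fgevalMl; apply: eq_fgeval => v.
exact: fgeval_nested_sum_harmonic_word.
Qed.

Lemma fgeval_nested_sum_harmonic_prod rs N :
  fgeval (nested_sum f ^~ N) (harmonic_prod rs) =
  \prod_(r <- rs) nested_sum f [:: r] N.
Proof.
have hproductM a b := fgeval_nested_sum_hproduct a b N.
rewrite (big_morph _ hproductM (fgevalU _ _)).
by apply: eq_bigr => r _; rewrite fgevalU.
Qed.

End HarmonicProductMorphism.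

Section RealSequences.
Variable R : realType.
Implicit Types (a b r x : R).

Lemma ln_ge1BV x : 0 < x -> 1 - x^-1 <= ln x.
Proof.
move=> x0; have : ln (1 + (x^-1 - 1)) <= x^-1 - 1.
  by apply: le_ln1Dx; rewrite ltrBrDl subrr invr_gt0.
by rewrite subrKC lnV ?posrE //; lra.
Qed.

(* [q `^ r = expR (r * ln q) >= 1 + r * ln q >= 1 + r * (1 - q^-1)] with
   [q := (x + 1) / x]. *)
Lemma powR_addr1_ge r x : 0 <= r -> 0 < x ->
  x `^ r * (1 + r / (x + 1)) <= (x + 1) `^ r.
Proof.
move=> r0 x0; have x1 : 0 < x + 1 by rewrite addr_gt0.
have q0 : 0 < (x + 1) / x by rewrite divr_gt0.
have -> : (x + 1) `^ r = x `^ r * ((x + 1) / x) `^ r.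
  by rewrite -powRM ?ltW // mulrC divfK ?gt_eqF.
rewrite ler_wpM2l ?powR_ge0 // [leRHS]/powR gt_eqF //.
apply: le_trans (expR_ge1Dx _); rewrite lerD2l ler_wpM2l //.
apply: le_trans (ln_ge1BV q0); rewrite invf_div.
by rewrite [leRHS](_ : _ = (x + 1)^-1) //; field; rewrite gt_eqF.
Qed.

Lemma riemannR_ge0 a m : 0 <= riemannR a m.
Proof. by rewrite invr_ge0 powR_ge0. Qed.

Lemma riemannR1 : riemannR 1 = @harmonic R.
Proof. by apply/funext => m; rewrite /riemannR powRr1. Qed.

Lemma riemannRD a b m : riemannR (a + b) m = riemannR a m * riemannR b m.
Proof. by rewrite /riemannR powRD ?pnatr_eq0 ?implybT // invfM. Qed.

Lemma norm_harmonic_diff_le m :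
  `|harmonic m.+1 - harmonic m| <= riemannR (2 : R) m.
Proof.
have -> : harmonic m.+1 - harmonic m = - (m.+1%:R * m.+2%:R)^-1 :> R.
  by rewrite /harmonic /=; field; rewrite nat1r -natrD !pnatr_eq0.
rewrite normrN ger0_norm ?invr_ge0 // /riemannR powR_mulrn //.
by rewrite lef_pV2 ?posrE // ?exprn_gt0 // -natrX -natrM ler_nat; nia.
Qed.

Lemma riemannR_le_diff a m : 0 < a ->
  riemannR (a + 1) m.+1 <= a^-1 * (riemannR a m - riemannR a m.+1).
Proof.
move=> a0; have x0 : (0 : R) < m.+1%:R by [].
rewrite ler_pdivlMl // riemannRD riemannR1 /riemannR /harmonic /=.
have := powR_addr1_ge (ltW a0) x0; rewrite natr1.
have := powR_gt0 a x0; have : 0 < m.+2%:R `^ a by rewrite powR_gt0.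
move: (m.+1%:R `^ _) (m.+2%:R `^ _) => y z z0 y0 yz.
rewrite mulrCA [leLHS]mulrC lerBrDr -[X in _ + X]mul1r -mulrDl addrC.
by rewrite ler_pdivrMr // ler_pdivlMl.
Qed.

Lemma cvg_riemannR a : 1 < a -> cvgn (series (riemannR a)).
Proof.
move=> a1; have r0 : 0 < a - 1 by rewrite subr_gt0.
rewrite -[a](subrK 1); move: (a - 1) r0 => r r0.
apply: nondecreasing_is_cvgn.
  by apply: nondecreasing_series => m _ _; exact: riemannR_ge0.
suff telescoped N :
    series (riemannR (r + 1)) N.+1 + r^-1 * riemannR r N <= 1 + r^-1.
  exists (1 + r^-1) => _ [N _ <-]; apply: le_trans (telescoped N).
  rewrite seriesSr -addrA lerDl addr_ge0 ?riemannR_ge0 //.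
  by rewrite mulr_ge0 ?riemannR_ge0 // invr_ge0 ltW.
elim: N => [|N IHN].
  rewrite seriesSr seriesEnat /= big_geq // /riemannR !powR1 invr1.
  by rewrite add0r mulr1.
apply: le_trans IHN; rewrite seriesSr -addrA lerD2l -lerBrDr -mulrBr.
exact: riemannR_le_diff.
Qed.

Lemma riemannR_cvg0 a : 0 < a -> riemannR a @ \oo --> 0.
Proof.
move=> a0; have -> : riemannR a = fun m => harmonic m `^ a.
  by apply/funext => m; rewrite -[LHS]powR_inv1 ?powR_ge0 // powRAC powR_inv1.
have /cvg_at_rightP := @powR_cvg0 R a a0; apply.
by split=> [m|]; [exact: harmonic_gt0|exact: cvg_harmonic].
Qed.

(* Adding the series to its own shift turns it into a series of differences. *)
Lemma cvg_alternating_series (u : R ^nat) : u @ \oo --> 0 ->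
  cvgn (series (fun m => (-1) ^+ m * (u m.+1 - u m))) ->
  cvgn (series (fun m => (-1) ^+ m.+1 * u m)).
Proof.
move=> /cvg_norm; rewrite normr0 => u0; set d := series _ => cvd.
have sgnu0 : (-1) ^+ N * u N @[N --> \oo] --> 0.
  apply: norm_cvg0; under eq_fun do rewrite normrMsign.
  exact: u0.
have -> : series (fun m => (-1) ^+ m.+1 * u m) =
    fun N => 2^-1 * (d N - u 0%N + (-1) ^+ N * u N).
  apply/funext; elim=> [|N IHN].
    by rewrite /d !seriesEnat /= !big_geq //; field.
  by rewrite seriesSr IHN /d seriesSr !exprS; field.
apply: is_cvgMl_tmp; apply: is_cvgD; last exact: cvgP sgnu0.
by apply: is_cvgB => //; exact: is_cvg_cst.
Qed.

End RealSequences.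

Section NestedSumConvergence.
Variables (R : realType) (T : Type) (f : T -> nat -> R).
Hypothesis f_le_harmonic : forall k m, `|f k m.+1| <= harmonic m.
Implicit Types (k : T) (u : seq T) (a e : R).

Lemma nested_sum_le e u N : 0 < e ->
  `|nested_sum f u N| <= (2 / e) ^+ size u * N.+1%:R `^ e.
Proof.
move=> e0; elim: u N => [|k u IHu] N.
  by rewrite normr1 expr0 mul1r -[leLHS](powRr0 N.+1%:R) ler_powR ?ler1n // ltW.
have C_ge0 d : 0 <= (2 / e) ^+ d by rewrite exprn_ge0 // divr_ge0 // ltW.
elim: N => [|N IHN].
  by rewrite nested_sum_cons0 normr0 mulr_ge0 ?powR_ge0.
have powR_growth : N.+1%:R `^ e * (1 + e / N.+2%:R) <= N.+2%:R `^ e.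
  by rewrite -[N.+2%:R]natr1; apply: powR_addr1_ge; [exact: ltW|].
apply: le_trans (ler_wpM2l (C_ge0 (size u).+1) powR_growth).
rewrite nested_sum_consS; apply: le_trans (ler_normD _ _) _; rewrite normrM.
apply: le_trans (lerD IHN (ler_pM _ _ (f_le_harmonic k N) (IHu N))) _ => //.
rewrite !mulrDr mulr1 lerD2l exprSr mulrACA mulrC.
rewrite ler_wpM2l ?mulr_ge0 ?powR_ge0 // mulrA divfK ?gt_eqF //.
by rewrite ler_pdivlMr // mulrC ler_pdivrMr // -natrM ler_nat; lia.
Qed.

Lemma riemannR_mul_nested_sum_le e a u m : 0 < e ->
  riemannR a m * `|nested_sum f u m| <= (2 / e) ^+ size u * riemannR (a - e) m.
Proof.
move=> e0; have -> : riemannR a m = riemannR (a - e) m * riemannR e m.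
  by rewrite -riemannRD subrK.
rewrite mulrAC -mulrA mulrC ler_wpM2r ?riemannR_ge0 //.
by rewrite ler_pdivrMr ?powR_gt0 // nested_sum_le.
Qed.

Lemma cvg_series_mul_nested_sum a (g : R ^nat) u : 1 < a ->
  (forall m, `|g m| <= riemannR a m) ->
  cvgn (series (fun m => g m * nested_sum f u m)).
Proof.
move=> a1 g_le; pose e := (a - 1) / 2.
have e0 : 0 < e by rewrite divr_gt0 ?subr_gt0.
apply: (@normed_cvg R R^o).
apply: (@series_le_cvg _ _ ((2 / e) ^+ size u *: riemannR (a - e))) => [m|m|m|].
- exact: normr_ge0.
- by rewrite mulr_ge0 ?riemannR_ge0 // exprn_ge0 // divr_ge0 // ltW.
- rewrite [leLHS]normrM; apply: le_trans (riemannR_mul_nested_sum_le _ _ _ e0).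
  by rewrite ler_wpM2r.
- by apply/is_cvg_seriesZ/cvg_riemannR; rewrite /e; lra.
Qed.

Lemma riemannR_mul_nested_sum_cvg0 a u : 0 < a ->
  riemannR a m * nested_sum f u m @[m --> \oo] --> 0.
Proof.
move=> a0; pose e := a / 2; have e0 : 0 < e by rewrite divr_gt0.
apply: norm_cvg0; apply: (@squeeze_cvgr _ _ _ _ (fun=> 0)
    (fun m => (2 / e) ^+ size u * riemannR (a - e) m)).
- near=> m; rewrite normr_ge0 normrM ger0_norm ?riemannR_ge0 //.
  exact: riemannR_mul_nested_sum_le.
- exact: cvg_cst.
- rewrite -[X in _ --> X](mulr0 ((2 / e) ^+ size u)).
  by apply: cvgMl_tmp; apply: riemannR_cvg0; rewrite /e; lra.
Unshelve. all: by end_near. Qed.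

Lemma cvg_series_mul_nested_sum_diff a (g : R ^nat) u : 0 < a ->
  (forall m, `|g m| <= riemannR a m) ->
  cvgn (series (fun m => g m * (nested_sum f u m.+1 - nested_sum f u m))).
Proof.
move=> a0 g_le; case: u => [|k v].
  under eq_fun do rewrite subrr mulr0; rewrite seriesEnat.
  by under eq_fun do rewrite big1_eq; exact: is_cvg_cst.
under eq_fun do rewrite nested_sum_consS [_ + _ * _]addrC addrK mulrA.
apply: (@cvg_series_mul_nested_sum (a + 1)) => [|m]; first by rewrite ltrDr.
by rewrite normrM riemannRD riemannR1 ler_pM.
Qed.

Lemma cvg_alternating_nested_sum u :
  cvgn (series (fun m => (-1) ^+ m.+1 * (harmonic m * nested_sum f u m))).
Proof.
apply: cvg_alternating_series.
  by rewrite -riemannR1; exact: riemannR_mul_nested_sum_cvg0.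
pose g m : R := (-1) ^+ m * harmonic m.+1.
pose h m : R := (-1) ^+ m * (harmonic m.+1 - harmonic m).
rewrite (_ : (fun m => _) =
    (fun m => g m * (nested_sum f u m.+1 - nested_sum f u m)) +
    (fun m => h m * nested_sum f u m)); last first.
  by apply/funext => m; rewrite addrfctE /g /h; ring.
apply: is_cvg_seriesD.
- apply: (@cvg_series_mul_nested_sum_diff 1) => // m.
  rewrite normrMsign riemannR1 ger0_norm ?harmonic_ge0 //.
  by rewrite lef_pV2 ?posrE // ler_nat.
- apply: (@cvg_series_mul_nested_sum 2) => [|m]; first by rewrite ltr1n.
  by rewrite normrMsign norm_harmonic_diff_le.
Qed.

End NestedSumConvergence.

Section Zeta.
Variable R : realType.
Implicit Types (k l n r : nzint) (u rs : seq nzint).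

Definition num_neg rs : nat := count (fun r => nzval r < 0) rs.

Definition zeta_term k m : R :=
  (sgz (nzval k))%:~R ^+ m / m%:R ^+ `|nzval k|%N.

Lemma zeta_partialE u : zeta_partial R u = nested_sum zeta_term u.
Proof. by apply/funext => N; exact: sum_tuple_sorted. Qed.

Lemma zeta_linE (a : sgroup) : zeta_lin R a = fgeval (zeta R) a.
Proof. by rewrite fgevalE; apply: eq_bigr => u _; rewrite mulrzl. Qed.

Lemma zeta_term_pmerge k l m :
  zeta_term (pmerge k l) m = zeta_term k m * zeta_term l m.
Proof.
by rewrite /zeta_term sgz_pmerge absz_pmerge rmorphM exprMn exprD invfM mulrACA.
Qed.

Lemma norm_zeta_term k m : `|zeta_term k m.+1| = riemannR `|nzval k|%:R m.
Proof.
rewrite normrM normrX normfV normrX normr_nat /riemannR powR_mulrn //.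
by rewrite -intr_norm normr_sgz nzval_neq0 expr1n mul1r.
Qed.

Lemma zeta_term_le k a m : a <= `|nzval k|%:R :> R ->
  `|zeta_term k m.+1| <= riemannR a m.
Proof.
move=> ak; rewrite norm_zeta_term lef_pV2 ?posrE ?powR_gt0 //.
by rewrite ler_powR // ler1n.
Qed.

Lemma zeta_term_le_harmonic k m : `|zeta_term k m.+1| <= harmonic m.
Proof.
by rewrite -riemannR1; apply: zeta_term_le; rewrite ler1n absz_gt0 nzval_neq0.
Qed.

Lemma zeta_term_N1 k m : nzval k = -1 ->
  zeta_term k m.+1 = (-1) ^+ m.+1 * harmonic m.
Proof. by rewrite /zeta_term => ->. Qed.

Lemma cvg_zeta_partial u : admissible u -> cvgn (zeta_partial R u).
Proof.
rewrite zeta_partialE; case: u => [_|n u /= n1]; first exact: is_cvg_cst.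
rewrite nested_sum_cons; have [n2|n_lt2] := leqP 2 `|nzval n|%N.
  apply: (cvg_series_mul_nested_sum zeta_term_le_harmonic (ltr1n R 2)) => m.
  by apply: zeta_term_le; rewrite ler_nat.
have nN1 : nzval n = -1 by have := nzval_neq0 n; lia.
under eq_fun do rewrite (zeta_term_N1 _ nN1) -mulrA.
exact: cvg_alternating_nested_sum zeta_term_le_harmonic u.
Qed.

Lemma Xharm_nested_sum r N :
  Xharm R r N = (-1) ^+ (nzval r < 0)%R * nested_sum zeta_term [:: r] N.
Proof.
rewrite nested_sum_cons seriesEnat /Xharm /harm /alt_harm /zeta_term /=.
rewrite big_add1 /=.
case: ltgtP (nzval_neq0 r) => // r0 _.
  rewrite mul1r; apply: eq_bigr => j _.
  by rewrite gtr0_sgz // expr1n mulr1 mul1r.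
rewrite big_add1 mulr_sumr; apply: eq_bigr => j _.
by rewrite ltr0_sgz // mulr1 exprS mulrA.
Qed.

Lemma prod_Xharm rs N : \prod_(r <- rs) Xharm R r N =
  (-1) ^+ num_neg rs *
  fgeval (nested_sum zeta_term ^~ N) (harmonic_prod rs).
Proof.
rewrite fgeval_nested_sum_harmonic_prod; last exact: zeta_term_pmerge.
elim: rs => [|r rs IHrs]; first by rewrite !big_nil mulr1.
by rewrite !big_cons IHrs Xharm_nested_sum /= exprD mulrACA.
Qed.

Lemma StermE n rs m :
  Sterm R n rs m = zeta_term n m.+1 * \prod_(r <- rs) Xharm R r m.
Proof.
rewrite /Sterm /zeta_term [RHS]mulrAC; case: ltgtP (nzval_neq0 n) => // n0 _.
  by rewrite gtr0_sgz // expr1n mul1r.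
by rewrite ltr0_sgz.
Qed.

Lemma SpartialE n rs N : (0 < size rs)%N -> Spartial R n rs N =
  (-1) ^+ num_neg rs *
  fgeval (zeta_partial R ^~ N.+1) (scons n (harmonic_prod rs)).
Proof.
move=> rs0; have Sterm0 : Sterm R n rs 0 = 0.
  case: rs rs0 => // r rs _.
  rewrite StermE big_cons Xharm_nested_sum nested_sum_cons0.
  by rewrite mulr0 mul0r mulr0.
under eq_fgeval do rewrite zeta_partialE.
rewrite fgeval_scons fgeval_nested_sum_cons mulr_sumr.
rewrite /Spartial -[LHS]add0r -{1}Sterm0 -big_ltn //.
by apply: eq_bigr => m _; rewrite StermE prod_Xharm mulrCA.
Qed.

Lemma cvg_Spartial n rs : nzval n != 1 -> (0 < size rs)%N ->
  Spartial R n rs @ \oo --> (-1) ^+ num_neg rs *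
    zeta_lin R (scons n (harmonic_prod rs)).
Proof.
move=> n1 rs0; rewrite (funext (fun N => SpartialE n N rs0)).
apply: cvgMl_tmp; rewrite zeta_linE.
rewrite (cvg_shiftS (fun N => fgeval (zeta_partial R ^~ N) _)).
by apply: cvg_fgeval => _ /dom_scons[u _ ->]; exact: cvg_zeta_partial.
Qed.

Lemma Ssum_zeta_lin n rs : nzval n != 1 -> (0 < size rs)%N ->
  Ssum R n rs = (-1) ^+ num_neg rs *
    zeta_lin R (scons n (harmonic_prod rs)).
Proof. by move=> n1 rs0; apply: cvg_lim => //; exact: cvg_Spartial. Qed.

End Zeta.

Theorem theorem2p1 (R : realType) (n : nzint) (rs : seq nzint)
    (hn : 0 < nzval n -> 2 <= nzval n) (hl : (0 < size rs)%N) :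
  let a := scons n (harmonic_prod rs) in
  [/\ cvgn (Spartial R n rs),
      forall ks, ks \in dom a -> admissible ks /\ cvgn (zeta_partial R ks),
      Ssum R n rs = (-1) ^+ count (fun r => nzval r < 0) rs * zeta_lin R a
    & exists (m : nat) (c : 'I_m -> int) (ks : 'I_m -> seq nzint),
        (forall i, [/\ admissible (ks i),
                       cvgn (zeta_partial R (ks i)),
                       weight (ks i) = (`|nzval n| + \sum_(r <- rs) `|nzval r|)%N
                     & (depth (ks i) <= (size rs).+1)%N])
        /\ Ssum R n rs = \sum_(i < m) (c i)%:~R * zeta R (ks i)].
Proof.
move=> a; have n1 : nzval n != 1 by apply: contraPneq hn => ->; apply/implyP.
have SsumE := Ssum_zeta_lin R n1 hl.
have dom_a ks : ks \in dom a -> [/\ admissible ks, cvgn (zeta_partial R ks),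
    weight ks = (`|nzval n| + weight rs)%N & (depth ks <= (size rs).+1)%N].
  move=> /dom_scons[u /dom_harmonic_prod[wu du] ->].
  by split; rewrite ?weight_cons ?wu //; exact: cvg_zeta_partial.
split=> [||//|].
- exact: cvgP (cvg_Spartial n1 hl).
- by move=> ks /dom_a[].
pose w (i : 'I_(size (dom a))) := nth [::] (dom a) i.
exists (size (dom a)).
exists (fun i => (-1) ^+ num_neg rs * coeff (w i) a), w.
split=> [i|]; first exact/dom_a/mem_nth.
rewrite SsumE /zeta_lin (big_nth [::]) big_mkord mulr_sumr.
by apply: eq_bigr => i _; rewrite rmorphM rmorphXn rmorphN1 mulrA.
Qed.
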